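(* Let $S$ be a $\mathrm{Cu}$-semigroup, let $x\in S$, and let $(x_n)_{n=1}^{\infty}$ be a sequence in $S$ with $x_n\leq x_{n+1}\leq x$ for all $n\in\mathbb{Z}_{>0}$. Then: (1) The sequence $(\rho(x_n,x))_{n=1}^{\infty}$ is an increasing sequence in $\mathbb{R}$, bounded above by $1$; so $\lim_{n\to\infty}\rho(x_n,x)$ exists in $\mathbb{R}$. If further $x_n\in\mathrm{Full}(S)$ for all $n\in\mathbb{Z}_{>0}$ and $\mathcal{F}_x(S)\neq\emptyset$, then $0<\lim_{n\to\infty}\rho(x_n,x)$. (2) The sequence $(\rho(x,x_n))_{n=1}^{\infty}$ is a decreasing sequence in $[0,\infty]$. If further $x_n\in\mathrm{Full}(S)$ for all $n\in\mathbb{Z}_{>0}$ and $\mathcal{F}_x(S)\neq\emptyset$, then $\lim_{n\to\infty}\rho(x,x_n)\geq 1$.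
   Context: For elements $x,y$ of a partially ordered set $P$, $x\ll y$ means: for every increasing sequence $(y_n)$ in $P$ with supremum $y$ there is $n_0$ with $x\leq y_{n_0}$. A $\mathrm{Cu}$-semigroup is a positively ordered abelian monoid $S$ (so $0\leq x$ for all $x$ and the order is compatible with addition) such that: (O1) every increasing sequence in $S$ has a supremum; (O2) every $x\in S$ is the supremum of a sequence $x_0\ll x_1\ll x_2\ll\cdots$; (O3) if $x'\ll x$ and $y'\ll y$ then $x'+y'\ll x+y$; (O4) $\sup_n(x_n+y_n)=\sup_n x_n+\sup_n y_n$ for all increasing sequences $(x_n),(y_n)$. ''Increasing'' and ''decreasing'' are meant in the weak sense. For $x\in S$, $\infty\cdot x=\sup_n n\cdot x$. An element $x$ is full if $\infty\cdot x$ is the largest element of $S$; $\mathrm{Full}(S)$ is the set of full elements. A functional on $S$ is a map $\lambda\colon S\to[0,\infty]$ that is additive, order preserving, satisfies $\lambda(0)=0$, and preserves suprema of increasing sequences. $\mathcal{F}(S)$ is the set of functionals on $S$, and $\mathcal{F}_z(S)=\{\lambda\in\mathcal{F}(S):\lambda(z)=1\}$ for $z\in S$. The rank of $x$ is $\widehat{x}\colon\mathcal{F}(S)\to[0,\infty]$, $\widehat{x}(\lambda)=\lambda(x)$. The rank ratio function is $\rho\colon S\times S\to[0,\infty]$, $\rho(x,y)=\inf\{r\in(0,\infty):\widehat{x}\leq r\cdot\widehat{y}\}$ (pointwise inequality on $\mathcal{F}(S)$), with $\rho(x,y)=\infty$ if there is no such $r$. *)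

(* Defs.v *)
From HB Require Import structures.
From mathcomp Require Import all_boot all_order all_algebra.
From mathcomp Require Import all_classical all_reals all_analysis.

Set Implicit Arguments.
Unset Strict Implicit.
Unset Printing Implicit Defensive.

Import Order.TTheory GRing.Theory Num.Theory.
Import numFieldNormedType.Exports.

Local Open Scope classical_set_scope.
Local Open Scope ring_scope.

Definition is_seq_sup d (P : porderType d) (u : nat -> P) (s : P) : Prop :=
  supremums (range u) s.

Definition way_below d (P : porderType d) (x y : P) : Prop :=
  forall u : nat -> P, nondecreasing_seq u -> is_seq_sup u y ->
    exists n0, (x <= u n0)%O.

(* The addition is part of the mixin, instead of being inherited from nmodType,
   because Num.POrderedZmodule is the only join of the ordered and the additive
   structures: HB rejects a further structure on top of both.  The nmodType
   structure is recovered just below. *)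
HB.mixin Record isCuSemigroup d S of Order.POrder d S := {
  cu0 : S;
  cu_add : S -> S -> S;
  cu_addA : associative cu_add;
  cu_addC : commutative cu_add;
  cu_add0 : left_id cu0 cu_add;
  cu_ge0 : forall x : S, (cu0 <= x)%O;
  cu_leD : forall x x' y y' : S,
    (x <= x')%O -> (y <= y')%O -> (cu_add x y <= cu_add x' y')%O;
  cu_O1 : forall u : nat -> S, nondecreasing_seq u -> exists s, is_seq_sup u s;
  cu_O2 : forall x : S, exists u : nat -> S,
    (forall n, way_below (u n) (u n.+1)) /\ is_seq_sup u x;
  cu_O3 : forall x' x y' y : S,
    way_below x' x -> way_below y' y -> way_below (cu_add x' y') (cu_add x y);
  cu_O4 : forall (u v : nat -> S) (s t : S),
    nondecreasing_seq u -> nondecreasing_seq v ->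
    is_seq_sup u s -> is_seq_sup v t ->
    is_seq_sup (fun n => cu_add (u n) (v n)) (cu_add s t)
}.

#[short(type="cuSemigroupType")]
HB.structure Definition CuSemigroup d :=
  { S of isCuSemigroup d S & Order.POrder d S }.

HB.instance Definition _ d (S : cuSemigroupType d) :=
  GRing.isNmodule.Build S cu_addA cu_addC cu_add0.

(* The default value 0 of [supremum] is never used: the multiples of x
   increase, hence have a supremum by (O1). *)
Definition infty_mul d (S : cuSemigroupType d) (x : S) : S :=
  supremum (0 : S) (range (fun n : nat => x *+ n : S)).

Definition Full d (S : cuSemigroupType d) : set S :=
  [set x | forall y, (y <= infty_mul x)%O].
Arguments Full {d} S.

Local Open Scope ereal_scope.

Record functional (R : realType) d (S : cuSemigroupType d) := Functional {
  functional_fun :> S -> \bar R;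
  functional_ge0 : forall x, 0 <= functional_fun x;
  functional0 : functional_fun 0%R = 0;
  functionalD : forall x y : S,
    functional_fun (x + y)%R = functional_fun x + functional_fun y;
  functional_homo : forall x y,
    (x <= y)%O -> functional_fun x <= functional_fun y;
  functional_sup : forall (u : nat -> S) (s : S),
    nondecreasing_seq u -> is_seq_sup u s ->
    functional_fun s = ereal_sup (range (fun n => functional_fun (u n)))
}.

Definition functionals_at (R : realType) d (S : cuSemigroupType d) (z : S) :
  set (functional R S) := [set lam | lam z = 1].
Arguments functionals_at R {d S} z.

Definition rank (R : realType) d (S : cuSemigroupType d) (x : S)
  (lam : functional R S) : \bar R := lam x.

(* [ereal_inf] of the empty set is +oo.  Since r is positive, r%:E * +oo = +oo. *)
Definition rank_ratio (R : realType) d (S : cuSemigroupType d) (x y : S) :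
  \bar R :=
  ereal_inf [set r%:E | r in
    [set r : R | (0 < r)%R /\
       forall lam : functional R S, rank x lam <= r%:E * rank y lam]].
Arguments rank_ratio R {d S} x y.

(* Main.v *)
(* If lam(x) = 1, then every r with rank x_n <= r * rank x satisfies
   lam(x_n) <= r, so rho(x_n, x) >= lam(x_0); this is positive when x_0 is
   full, since otherwise lam would vanish on infty * x_0 >= x. Likewise
   1 = lam(x) <= r * lam(x_n) <= r gives rho(x, x_n) >= 1. *)
Require Import Defs.
From HB Require Import structures.
From mathcomp Require Import all_boot all_order all_algebra.
From mathcomp Require Import all_classical all_reals all_analysis.

Import Order.TTheory GRing.Theory Num.Theory.
Import numFieldNormedType.Exports.

Local Open Scope classical_set_scope.
Local Open Scope ereal_scope.

Section RankRatio.
Set Implicit Arguments.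
Unset Strict Implicit.
Unset Printing Implicit Defensive.
Context (R : realType) (d : Order.disp_t) (S : cuSemigroupType d).
Implicit Types (x y : S) (lam : functional R S).

Lemma mulrn_nondecreasing x : nondecreasing_seq (fun n => (x *+ n)%R : S).
Proof.
apply/nondecreasing_seqP => n; rewrite mulrS -[leLHS]add0r.
by apply: cu_leD => //; exact: cu_ge0.
Qed.

Lemma infty_mul_sup x : is_seq_sup (fun n => (x *+ n)%R : S) (infty_mul x).
Proof.
(* [supremum] returns its default only on an empty range, which [x *+ 0] rules out. Otherwise it
   chooses among the suprema, and (O1) provides one. *)
rewrite /infty_mul /supremum; case: eqP => [E|_].
  have : range (fun n => (x *+ n)%R : S) (x *+ 0)%R by exists 0%N.
  by rewrite E.
have [s xs] := cu_O1 _ (mulrn_nondecreasing x).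
exact: (xgetI _ xs).
Qed.

Lemma functional_mulrn lam x n : lam x = 0 -> lam (x *+ n)%R = 0.
Proof.
move=> lx0; elim: n => [|n IHn]; first by rewrite mulr0n functional0.
by rewrite mulrS functionalD lx0 IHn adde0.
Qed.

(** A zero of [lam] at [x] spreads to all multiples of [x] by additivity, then to [infty_mul x] by
    preservation of suprema, and fullness puts [y] below that element. *)
Lemma functional_Full_gt0 lam x y : Full S x -> 0 < lam y -> 0 < lam x.
Proof.
move=> xF ly0; rewrite lt0e functional_ge0 andbT; apply/eqP => lx0.
have := lt_le_trans ly0 (functional_homo lam (xF y)).
rewrite (functional_sup lam (mulrn_nondecreasing x) (infty_mul_sup x)).
apply/negP; rewrite -leNgt; apply: ge_ereal_sup => _ [n _ <-].
by rewrite functional_mulrn.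
Qed.

Lemma rank_ratio_ge0 x y : 0 <= rank_ratio R x y.
Proof. by apply: le_ereal_inf_tmp => _ [r [r0 _] <-]; rewrite lee_fin ltW. Qed.

Lemma rank_ratio_le1 x y : (x <= y)%O -> rank_ratio R x y <= 1.
Proof.
move=> xy; apply: ereal_inf_lbound; exists 1%R => //; split=> // lam.
by rewrite mul1e; exact: functional_homo.
Qed.

(** Every constant admissible for [(x', y')] is admissible for [(x, y)], so the infimum on the left
    is over a larger set. This yields the monotonicity of both sequences. *)
Lemma rank_ratio_le x x' y y' : (x <= x')%O -> (y' <= y)%O ->
  rank_ratio R x y <= rank_ratio R x' y'.
Proof.
move=> xx' yy'; apply: ereal_inf_le_tmp => _ [r [r0 rP] <-]; exists r => //.
split=> // lam; apply: le_trans (functional_homo lam xx') _.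
apply: le_trans (rP lam) _; apply: lee_wpmul2l; first by rewrite lee_fin ltW.
exact: functional_homo.
Qed.

Lemma functional_le_rank_ratio lam x y : lam y = 1 -> lam x <= rank_ratio R x y.
Proof.
move=> ly1; apply: le_ereal_inf_tmp => _ [r [_ rP] <-]; have := rP lam.
by rewrite /rank ly1 mule1.
Qed.

Lemma rank_ratio_ge1 lam x y :
  (y <= x)%O -> lam x = 1 -> 1 <= rank_ratio R x y.
Proof.
move=> yx lx1; apply: le_ereal_inf_tmp => _ [r [r0 rP] <-]; have := rP lam.
rewrite /rank lx1 => /le_trans; apply.
rewrite -[leRHS]mule1; apply: lee_wpmul2l; first by rewrite lee_fin ltW.
by rewrite -lx1; exact: functional_homo.
Qed.

End RankRatio.

Theorem theorem4p8 (R : realType) (d : Order.disp_t) (S : cuSemigroupType d)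
    (x : S) (x_ : nat -> S)
    (x_incr : forall n, (x_ n <= x_ n.+1)%O)
    (x_le : forall n, (x_ n <= x)%O) :
  ([/\ forall n, rank_ratio R (x_ n) x \is a fin_num,
       nondecreasing_seq (fun n => fine (rank_ratio R (x_ n) x)),
       forall n, (fine (rank_ratio R (x_ n) x) <= 1)%R,
       cvgn (fun n => fine (rank_ratio R (x_ n) x)) &
       (forall n, Full S (x_ n)) -> functionals_at R x !=set0 ->
         (0 < limn (fun n => fine (rank_ratio R (x_ n) x)))%R])
  /\
  ([/\ forall n, 0 <= rank_ratio R x (x_ n),
       nonincreasing_seq (fun n => rank_ratio R x (x_ n)) &
       (forall n, Full S (x_ n)) -> functionals_at R x !=set0 ->
         cvgn (fun n => rank_ratio R x (x_ n)) /\
         1 <= limn (fun n => rank_ratio R x (x_ n))]).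
Proof.
have x_fin n : rank_ratio R (x_ n) x \is a fin_num.
  (* The ratio lies between 0 and 1, so passing to real numbers by [fine] loses nothing. *)
  rewrite ge0_fin_numE ?rank_ratio_ge0//.
  exact: le_lt_trans (rank_ratio_le1 R (x_le n)) (ltry _).
have rho_nd : nondecreasing_seq (fun n => fine (rank_ratio R (x_ n) x)).
  by apply/nondecreasing_seqP => n; apply: fine_le => //; exact: rank_ratio_le.
have rho_le1 n : (fine (rank_ratio R (x_ n) x) <= 1)%R.
  by rewrite -lee_fin fineK//; exact: rank_ratio_le1.
have rho_cvg : cvgn (fun n => fine (rank_ratio R (x_ n) x)).
  by apply: nondecreasing_is_cvgn => //; exists 1%R => _ [n _ <-].
have rho_ni : nonincreasing_seq (fun n => rank_ratio R x (x_ n)).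
  by apply/nonincreasing_seqP => n; exact: rank_ratio_le.
split; split=> //.
- move=> xF [lam lx1].
  (* The limit of an increasing sequence dominates its first term, so it is enough that this term is
     positive. *)
  apply: lt_le_trans (nondecreasing_cvgn_le rho_nd rho_cvg 0%N).
  rewrite -lte_fin fineK//.
  apply: lt_le_trans (functional_le_rank_ratio (x_ 0%N) lx1).
  by apply: (functional_Full_gt0 (y := x)) (xF 0%N) _; rewrite lx1.
- by move=> n; exact: rank_ratio_ge0.
(* A decreasing sequence of extended reals converges even if some terms are [+oo], and the bound 1
   on each term passes to the limit. *)
- move=> _ [lam lx1]; have rho_cv := ereal_nonincreasing_is_cvgn rho_ni.
  split=> //; apply: lime_ge => //; apply: nearW => n.
  exact: rank_ratio_ge1 (x_le n) lx1.
Qed.
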